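(* Let $A\in\mathbb{C}^{d\times d}$ be a normal matrix, let $z_0\in\mathbb{C}$ and let $\rho$ be a real number with $0<\rho<|z_0|$, and suppose that the spectrum $\sigma(A)$ satisfies $$\sigma(A)\subseteq \overline{\mathcal{B}_{\rho}(z_0)}=\{w\in\mathbb{C} : |w-z_0|\le\rho\}.$$ Let $k\ge 1$ be an integer and $b\in\mathbb{C}^d$. Then, for any initial guess $x_0\in\mathbb{C}^d$, the residuals $r_n^{(k)}$ obtained by applying the Orthomin($k$) iteration to the system $Ax=b$ satisfy $$\|r_{n+1}^{(k)}\|\le \frac{\rho}{|z_0|}\,\|r_n^{(k)}\|$$ for all $n\ge 0$ for which the iteration is defined.
   Context: The inner product on $\mathbb{C}^d$ is $(u,v)=\sum_{j=1}^d u_j\overline{v_j}$ and $\|u\|=\sqrt{(u,u)}$. Orthomin($k$) for $Ax=b$ with initial guess $x_0\in\mathbb{C}^d$: set $p_0=r_0=b-Ax_0$, and for $n\ge 0$ define $$\lambda_n=\frac{(r_n,Ap_n)}{(Ap_n,Ap_n)},\qquad x_{n+1}=x_n+\lambda_np_n,\qquad r_{n+1}=r_n-\lambda_nAp_n,$$ $$\nu_n^{(j)}=\frac{(Ar_{n+1},Ap_{n-j+1})}{(Ap_{n-j+1},Ap_{n-j+1})}\quad\text{for } j=1,\dots,\min(k-1,n+1),\qquad p_{n+1}=r_{n+1}-\sum_{j=1}^{\min(k-1,n+1)}\nu_n^{(j)}p_{n-j+1}.$$ (For $k=1$ the sum is empty, so $p_{n+1}=r_{n+1}$.) The vector $r_n^{(k)}=r_n$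 is the $n$-th residual. The iteration stops at step $n$ if $Ap_n=0$; $r_{n+1}$ is defined as long as $Ap_0,\dots,Ap_n$ are nonzero. *)

(* Defs.v *)
From HB Require Import structures.
From mathcomp Require Import all_boot all_order all_algebra.
From mathcomp Require Import complex.
From mathcomp Require Import reals.

Set Implicit Arguments.
Unset Strict Implicit.
Unset Printing Implicit Defensive.

Import Order.TTheory GRing.Theory Num.Theory.
Local Open Scope ring_scope.

(* The definitions make sense over any numClosedFieldType C;
   the intended instance is C = R[i] with R : realType. *)

Section Orthomin.
Variables (C : numClosedFieldType) (d : nat).
Implicit Types (u v : 'cV[C]_d).

Definition inner u v : C := \sum_(j < d) u j 0 * (v j 0)^*.

(* [inner u u] is a nonnegative real element of C, so the values of [vnorm]
   are too, and comparing them with the order of C is comparing reals. *)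
Definition vnorm u : C := sqrtC (inner u u).

Variables (A : 'M[C]_d) (b : 'cV[C]_d) (k : nat) (x0 : 'cV[C]_d).

(* [odirs] lists the directions generated so far, most recent first; after n
   steps it is [:: p_n; ...; p_0]. *)
Record orthomin_state := OrthominState {
  oiter : 'cV[C]_d;
  ores : 'cV[C]_d;
  odirs : seq 'cV[C]_d
}.

Definition orthomin_init : orthomin_state :=
  OrthominState x0 (b - A *m x0) [:: b - A *m x0].

(* In step n the state has [size odirs = n.+1] and p_(n-j+1) is
   [odirs`_(j.-1)]. Division by zero yields zero, so the step is total; its
   result is meaningful only if A p_n != 0. *)
Definition orthomin_step (s : orthomin_state) : orthomin_state :=
  let x := oiter s in
  let r := ores s in
  let P := odirs s in
  let p := P`_0 in
  let lambda := inner r (A *m p) / inner (A *m p) (A *m p) in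
  let r' := r - lambda *: (A *m p) in
  let nu j := inner (A *m r') (A *m P`_(j.-1))
              / inner (A *m P`_(j.-1)) (A *m P`_(j.-1)) in
  let p' := r' - \sum_(1 <= j < (minn (k - 1) (size P)).+1)
                   nu j *: P`_(j.-1) in
  OrthominState (x + lambda *: p) r' (p' :: P).

Definition orthomin n : orthomin_state := iter n orthomin_step orthomin_init.

Definition iterate n : 'cV[C]_d := oiter (orthomin n).
Definition residual n : 'cV[C]_d := ores (orthomin n).
Definition direction n : 'cV[C]_d := (odirs (orthomin n))`_0.

(* r_(n+1) is defined exactly when the iteration has not stopped at any of the
   steps 0, ..., n. *)
Definition orthomin_defined n : Prop :=
  forall m, (m <= n)%N -> A *m direction m != 0.

Definition lambda n : C :=
  inner (residual n) (A *m direction n)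
  / inner (A *m direction n) (A *m direction n).

Definition nu n j : C :=
  inner (A *m residual n.+1) (A *m direction (n.+1 - j))
  / inner (A *m direction (n.+1 - j)) (A *m direction (n.+1 - j)).

Lemma size_odirs n : size (odirs (orthomin n)) = n.+1.
Proof. by elim: n => //= n ->. Qed.

Lemma nth_odirs n i : (i <= n)%N ->
  (odirs (orthomin n))`_i = direction (n - i).
Proof.
elim: n i => [|n IHn] [|i] //.
by move=> le_in; rewrite subSS -IHn.
Qed.

Lemma residual0 : residual 0 = b - A *m x0. Proof. by []. Qed.

Lemma direction0 : direction 0 = residual 0. Proof. by []. Qed.

Lemma iterateS n : iterate n.+1 = iterate n + lambda n *: direction n.
Proof. by []. Qed.

Lemma residualS n :
  residual n.+1 = residual n - lambda n *: (A *m direction n).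
Proof. by []. Qed.

Lemma directionS n :
  direction n.+1 = residual n.+1
    - \sum_(1 <= j < (minn (k - 1) n.+1).+1) nu n j *: direction (n.+1 - j).
Proof.
rewrite {1}/direction /= -/(residual n.+1) size_odirs; congr (_ - _).
apply: eq_big_nat => -[//|j] /andP[_]; rewrite ltnS leq_min => /andP[_ le_jn].
by rewrite /nu subSS -(nth_odirs le_jn).
Qed.

End Orthomin.

(* Main.v *)
(** In step [n] the vector [A r_n] lies in the span of [A p_n] and of the
    previous [A p_(n-j)], [1 <= j <= k-1], and [r_(n+1)] is orthogonal to this
    span.  Hence, by Pythagoras, [‖r_(n+1)‖ <= ‖r_n - c A r_n‖] for every
    scalar [c].  Taking [c = 1/z0] and diagonalizing the normal matrix [A] in an
    orthonormal basis bounds the right-hand side by [(rho/|z0|) ‖r_n‖]. *)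

Require Import Defs.
From mathcomp Require Import all_boot all_order all_algebra.
From mathcomp Require Import complex.
From mathcomp Require Import reals.
From mathcomp Require Import zify.

Set Implicit Arguments.
Unset Strict Implicit.
Unset Printing Implicit Defensive.

Import Order.TTheory GRing.Theory Num.Theory.
Local Open Scope ring_scope.
Local Open Scope sesquilinear_scope.

Section Inner.
Variables (C : numClosedFieldType) (d : nat).
Implicit Types (u v w : 'cV[C]_d) (c : C).

Lemma innerE u v : inner u v = (v ^t* *m u) 0 0.
Proof. by rewrite mxE; apply: eq_bigr => j _; rewrite !mxE mulrC. Qed.

Lemma inner_conj u v : (inner u v)^* = inner v u.
Proof.
rewrite rmorph_sum; apply: eq_bigr => j _.
by rewrite rmorphM /= conjCK mulrC.
Qed.

Lemma inner_eq0_sym u v : inner u v = 0 -> inner v u = 0.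
Proof. by move=> uv0; rewrite -inner_conj uv0 conjC0. Qed.

Lemma innerDl u v w : inner (u + v) w = inner u w + inner v w.
Proof. by rewrite !innerE mulmxDr mxE. Qed.

Lemma innerZl c u v : inner (c *: u) v = c * inner u v.
Proof. by rewrite !innerE -scalemxAr mxE. Qed.

Lemma innerBl u v w : inner (u - v) w = inner u w - inner v w.
Proof. by rewrite -scaleN1r innerDl innerZl mulN1r. Qed.

Lemma inner0r u : inner u 0 = 0.
Proof. by rewrite /inner big1 // => j _; rewrite mxE conjC0 mulr0. Qed.

Lemma inner_suml (I : Type) (s : seq I) (P : pred I) (F : I -> 'cV[C]_d) v :
  inner (\sum_(i <- s | P i) F i) v = \sum_(i <- s | P i) inner (F i) v.
Proof.
elim/big_rec2: _ => [|i y x _ <-]; last by rewrite innerDl.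
by apply: inner_eq0_sym; rewrite inner0r.
Qed.

Lemma innerDr u v w : inner u (v + w) = inner u v + inner u w.
Proof. by rewrite -inner_conj innerDl rmorphD /= !inner_conj. Qed.

Lemma innerZr c u v : inner u (c *: v) = c^* * inner u v.
Proof. by rewrite -inner_conj innerZl rmorphM /= inner_conj. Qed.

Lemma innervv u : inner u u = \sum_j `|u j 0| ^+ 2.
Proof. by apply: eq_bigr => j _; rewrite normCK. Qed.

Lemma innervv_ge0 u : 0 <= inner u u.
Proof. by rewrite innervv sumr_ge0 // => j _; rewrite exprn_ge0. Qed.

Lemma innervv_eq0 u : inner u u = 0 -> u = 0.
Proof.
rewrite innervv => /psumr_eq0P u0; apply/matrixP => j l; rewrite ord1 mxE.
by apply/eqP; rewrite -normr_eq0 -sqrf_eq0 u0 // => i _; rewrite exprn_ge0.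
Qed.

(* Also holds for [v = 0], where the quotient is [0]. *)
Lemma inner_proj u v : inner (u - (inner u v / inner v v) *: v) v = 0.
Proof.
rewrite innerBl innerZl; have [/innervv_eq0 ->|vv0] := eqVneq (inner v v) 0.
  by rewrite !inner0r mulr0 subrr.
by rewrite divfK // subrr.
Qed.

Lemma vnorm_ge0 u : 0 <= vnorm u.
Proof. by rewrite sqrtC_ge0 innervv_ge0. Qed.

Lemma ler_vnorm c u v : 0 <= c ->
  inner u u <= c ^+ 2 * inner v v -> vnorm u <= c * vnorm v.
Proof.
move=> c0 le_uv; rewrite -(@ler_pXn2r _ 2) ?nnegrE ?mulr_ge0 ?vnorm_ge0 //.
by rewrite exprMn !sqrtCK.
Qed.

Lemma vnormZ c u : vnorm (c *: u) = `|c| * vnorm u.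
Proof.
rewrite /vnorm innerZl innerZr mulrA -normCK rootCMl ?exprn_ge0 //.
by rewrite sqrCK.
Qed.

Lemma vnorm_pythagoras u v : inner u v = 0 -> vnorm u <= vnorm (u + v).
Proof.
move=> uv0; rewrite -[leRHS]mul1r; apply: ler_vnorm => //.
rewrite expr1n mul1r innerDl !innerDr uv0 (inner_eq0_sym uv0) addr0 add0r.
by rewrite lerDl innervv_ge0.
Qed.

Lemma inner_unitary (P : 'M[C]_d) u v :
  P \is unitarymx -> inner (P *m u) (P *m v) = inner u v.
Proof.
(* [unitarymxP] for [P] would give [P *m P ^t* = 1]; passing to the adjoint gives the product in the
   other order, which is the one that appears here. *)
rewrite -trmxC_unitary => /unitarymxP; rewrite trmxCK => PP.
by rewrite !innerE trmx_mul map_mxM mulmxA -(mulmxA _ (P ^t*)) PP mulmx1.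
Qed.

(** In a unitary eigenbasis [A - z] is diagonal with entries of modulus at most [c], so each
    coordinate of [v] grows by a factor of at most [c]. *)
Lemma normal_shift_bound (A : 'M[C]_d) (z c : C) v :
    A \is normalmx -> 0 <= c ->
    (forall w : C, eigenvalue A w -> `|w - z| <= c) ->
  vnorm (A *m v - z *: v) <= c * vnorm v.
Proof.
move=> /orthomx_spectralP; set P := spectralmx A; set D := spectral_diag A.
move=> A_eq c0 A_c.
have Pu : P \is unitarymx by apply: spectral_unitarymx.
have PA : P *m A = diag_mx D *m P.
  by rewrite A_eq -mulmxA mulKVmx ?spectral_unit.
(* [eigenvalue] refers to row eigenvectors: the one for [D 0 i] is row [i] of [P], nonzero because
   the rows of a unitary matrix have norm 1. *)
have D_c i : `|D 0 i - z| <= c.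
  apply/A_c/eigenvalueP; exists (row i P).
    by rewrite -row_mul PA row_mul row_diag_mx -scalemxAl -rowE.
  apply/eqP => Pi0; have /row_unitarymxP/(_ i i) := Pu.
  by rewrite Pi0 linear0l eqxx => /esym/eqP; rewrite oner_eq0.
apply: ler_vnorm => //; rewrite -(inner_unitary _ _ Pu) -(inner_unitary v v Pu).
rewrite mulmxBr mulmxA PA -scalemxAr -mulmxA !innervv mulr_sumr.
apply: ler_sum => i _; rewrite mul_diag_mx !mxE -mulrBl normrM exprMn.
by rewrite ler_wpM2r ?exprn_ge0 // ler_pXn2r ?nnegrE.
Qed.

End Inner.

Section OrthominTheory.
Variables (C : numClosedFieldType) (d : nat) (A : 'M[C]_d) (b : 'cV[C]_d).
Variables (k : nat) (x0 : 'cV[C]_d).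
Local Notation r := (residual A b k x0).
Local Notation p := (direction A b k x0).
Local Notation lambda := (lambda A b k x0).
Local Notation nu := (nu A b k x0).

(** This is Gram-Schmidt on a sliding window: the coefficients [nu] remove from [A r_m] its
    components along the latest [k - 1] vectors [A p_l], which are pairwise orthogonal by
    induction. *)
Lemma direction_orthogonal m l : (l < m)%N -> (m <= l + (k - 1))%N ->
  inner (A *m p m) (A *m p l) = 0.
Proof.
elim/ltn_ind: m l => -[//|m] IH l lt_lm le_ml.
pose F j := nu m j *: (A *m p (m.+1 - j)).
have ApE : A *m p m.+1 =
    A *m r m.+1 - \sum_(1 <= j < (minn (k - 1) m.+1).+1) F j.
  rewrite directionS mulmxBr mulmx_sumr; congr (_ - _).
  by apply: eq_bigr => j _; rewrite -scalemxAr.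
(* The summand with index [m.+1 - l] is the projection of [A r_(m+1)] onto [A p_l]; it is split off,
   and all other summands are orthogonal to [A p_l]. *)
have i_in : (m.+1 - l)%N \in index_iota 1 (minn (k - 1) m.+1).+1.
  by rewrite mem_index_iota; lia.
rewrite ApE (bigD1_seq _ i_in) ?iota_uniq //= opprD addrA innerBl inner_suml.
rewrite /F /Defs.nu subKn; last exact: ltnW.
rewrite inner_proj big_seq_cond big1 ?subrr // => j.
rewrite mem_index_iota => /andP[j_in neq_j].
rewrite innerZl; suff -> : inner (A *m p (m.+1 - j)) (A *m p l) = 0.
  by rewrite mulr0.
(* Both indices lie in the window just below [m.+1], so [IH] applies at the larger of the two. *)
case: (ltngtP (m.+1 - j)%N l) => [lt|lt|eq]; last by lia.
- by apply: inner_eq0_sym; apply: IH; lia.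
- by apply: IH; lia.
Qed.

(** The choice of [lambda] handles the newest direction. Subtracting a multiple of the newest [A p]
    preserves the older relations by [direction_orthogonal], so the window is one longer than
    there. *)
Lemma residual_orthogonal m l : (l < m)%N -> (m <= l + k)%N ->
  inner (r m) (A *m p l) = 0.
Proof.
elim: m => // m IH lt_lm le_ml; rewrite residualS.
have [->|neq_lm] := eqVneq l m; first exact: inner_proj.
rewrite innerBl innerZl IH; try lia.
by rewrite direction_orthogonal ?mulr0 ?subrr //; lia.
Qed.

(** Solving the recurrence of [p] for [r m] involves [p m] and at most [k - 1] earlier directions,
    exactly the [k] covered by [residual_orthogonal]. *)
Lemma residual_orthogonal_image m : (0 < k)%N ->
  inner (r m.+1) (A *m r m) = 0.
Proof.
move=> k_gt0; have r_Ap : inner (r m.+1) (A *m p m) = 0.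
  by apply: residual_orthogonal; lia.
(* For [m = 0] the claim is [r_Ap] itself, as [p 0] is [r 0]. *)
case: m r_Ap => [//|m] r_Ap.
have -> : r m.+1 = p m.+1 +
    \sum_(1 <= j < (minn (k - 1) m.+1).+1) nu m j *: p (m.+1 - j).
  by rewrite directionS subrK.
rewrite mulmxDr innerDr r_Ap add0r mulmx_sumr.
apply: inner_eq0_sym; rewrite inner_suml big_nat big1 // => j j_in.
rewrite -scalemxAr innerZl inner_eq0_sym ?mulr0 //.
by apply: residual_orthogonal; lia.
Qed.

(** The two vectors differ by a combination of [A p_m] and [A r_m], both orthogonal to [r m.+1]. *)
Lemma residual_minimal m (c : C) : (0 < k)%N ->
  vnorm (r m.+1) <= vnorm (r m - c *: (A *m r m)).
Proof.
move=> k_gt0.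
have -> : r m - c *: (A *m r m) =
    r m.+1 + (lambda m *: (A *m p m) - c *: (A *m r m)).
  by rewrite residualS addrA subrK.
apply: vnorm_pythagoras; apply: inner_eq0_sym; rewrite innerBl !innerZl.
rewrite !(inner_eq0_sym (u := r m.+1)) ?mulr0 ?subrr //.
  exact: residual_orthogonal_image.
by apply: residual_orthogonal; lia.
Qed.

End OrthominTheory.

Local Open Scope complex_scope.

Theorem theorem2 (R : realType) (d : nat) (A : 'M[R[i]]_d) (z0 : R[i]) (rho : R)
    (A_normal : A \is normalmx)
    (rho_gt0 : 0 < rho) (rho_lt : rho%:C < `|z0|)
    (spectrum_A : forall w : R[i], eigenvalue A w -> `|w - z0| <= rho%:C)
    (k : nat) (k_ge1 : (1 <= k)%N) (b : 'cV[R[i]]_d) (x0 : 'cV[R[i]]_d) (n : nat)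
    (defined_n : orthomin_defined A b k x0 n) :
  vnorm (residual A b k x0 n.+1)
    <= rho%:C / `|z0| * vnorm (residual A b k x0 n).
Proof.
have rho_ge0 : 0 <= rho%:C by rewrite lecR ltW.
have z0_neq0 : z0 != 0 by rewrite -normr_gt0 (le_lt_trans rho_ge0).
apply: (le_trans (residual_minimal _ _ _ n z0^-1 k_ge1)).
set v := residual _ _ _ _ n.
have -> : v - z0^-1 *: (A *m v) = - z0^-1 *: (A *m v - z0 *: v).
  by rewrite scaleNr scalerBr scalerA mulVf // scale1r opprB.
rewrite vnormZ normrN normfV mulrAC mulrC.
by rewrite ler_wpM2r ?invr_ge0 // normal_shift_bound.
Qed.
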